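(* Let $\mathcal{D}$ be a distribution on $\mathbb{R}^d$, $w_*\in\mathbb{R}^d$, and let $\sigma:\mathbb{R}\to\mathbb{R}$ be $L_0$-Lipschitz and $\alpha$-increasing, i.e. $\sigma'(z)\ge\alpha>0$ for all $z\in\mathbb{R}$. Let $$f(w)=\mathbb{E}_{x\sim\mathcal{D}}\left[\tfrac12\left(\sigma(w^\top x)-y\right)^2\right],\qquad y=\sigma(w_*^\top x).$$ Then $f$ is $\alpha^2$-generalized variational coherent and $\frac{L_0^2}{2}$-generalized smooth with respect to $h(w,w_* )=\mathbb{E}_{x\sim\mathcal{D}}\left[\left((w-w_* )^\top x\right)^2\right]$. Therefore $f$ is $\rho$-quasar convex with $\rho=\frac{2\alpha^2}{L_0^2}$.
   Context: $f$ is understood as a real-valued function on $\mathbb{R}^d$ (the defining expectation is finite for every $w$); $w_*$ is a global minimizer of $f$. $f$ is $C_v$-generalized variational coherent with respect to a non-negative function $h$ if $\langle\nabla f(w),w-w_*\rangle\ge C_v\,h(w,w_* )$ for all $w\in\mathbb{R}^d$. $f$ is $C_l$-generalized smooth with respect to $h$ if $f(w)-f(w_* )\le C_l\,h(w,w_* )$ for all $w\in\mathbb{R}^d$. $f$ is $\rho$-quasar convex ($\rho>0$) if $f(w_* )\ge f(w)+\frac1\rho\langle\nabla f(w),w_*-w\rangle$ for all $w\in\mathbb{R}^d$. *)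

(* Defs.v *)
From HB Require Import structures.
From mathcomp Require Import all_boot all_order all_algebra.
From mathcomp Require Import all_classical all_reals all_analysis.

Set Implicit Arguments.
Unset Strict Implicit.
Unset Printing Implicit Defensive.

Import Order.TTheory GRing.Theory Num.Theory.
Import numFieldNormedType.Exports.

Local Open Scope classical_set_scope.
Local Open Scope ring_scope.

(* R^d (row vectors) with the sigma-algebra generated by its open sets. *)
Notation borel_rV R d := (g_sigma_algebraType (@open 'rV[R]_d)).

Definition dot (R : realType) (d : nat) (u v : 'rV[R]_d) : R :=
  (u *m v^T) 0 0.

Definition gradient (R : realType) (d : nat) (f : 'rV[R]_d -> R)
    (w : 'rV[R]_d) : 'rV[R]_d :=
  \row_i 'D_(delta_mx 0 i) f w.

Definition global_minimizer (R : realType) (d : nat) (f : 'rV[R]_d -> R)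
    (ws : 'rV[R]_d) : Prop :=
  forall w, f ws <= f w.

(* The three notions below are relative to a global minimizer [ws] of [f].
   Differentiability is required wherever the gradient occurs, since the
   library's derivative is a total operator.  The function [h] may be an
   expectation, hence its extended real values. *)

Definition generalized_variational_coherent (R : realType) (d : nat)
    (f : 'rV[R]_d -> R) (ws : 'rV[R]_d)
    (h : 'rV[R]_d -> 'rV[R]_d -> \bar R) (Cv : R) : Prop :=
  [/\ global_minimizer f ws,
      forall u v, (0 <= h u v)%E,
      forall w, differentiable f w &
      forall w, (Cv%:E * h w ws <= (dot (gradient f w) (w - ws))%:E)%E].

Definition generalized_smooth (R : realType) (d : nat)
    (f : 'rV[R]_d -> R) (ws : 'rV[R]_d)
    (h : 'rV[R]_d -> 'rV[R]_d -> \bar R) (Cl : R) : Prop :=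
  [/\ global_minimizer f ws,
      forall u v, (0 <= h u v)%E &
      forall w, ((f w - f ws)%:E <= Cl%:E * h w ws)%E].

Definition quasar_convex (R : realType) (d : nat)
    (f : 'rV[R]_d -> R) (ws : 'rV[R]_d) (rho : R) : Prop :=
  [/\ 0 < rho,
      global_minimizer f ws,
      forall w, differentiable f w &
      forall w, f w + rho^-1 * dot (gradient f w) (ws - w) <= f ws].

Definition alpha_increasing (R : realType) (alpha : R) (sigma : R -> R) : Prop :=
  0 < alpha /\ forall z, derivable sigma z 1 /\ alpha <= derive1 sigma z.

Definition expected_loss (R : realType) (d : nat)
    (D : probability (borel_rV R d) R) (sigma : R -> R)
    (ws w : 'rV[R]_d) : \bar R :=
  'E_D[fun x : 'rV[R]_d =>
         2^-1 * (sigma (dot w x) - sigma (dot ws x)) ^+ 2].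

Definition mean_square_gap (R : realType) (d : nat)
    (D : probability (borel_rV R d) R) (u v : 'rV[R]_d) : \bar R :=
  'E_D[fun x : 'rV[R]_d => dot (u - v) x ^+ 2].

(* Main.v *)
Require Import Defs.
From HB Require Import structures.
From mathcomp Require Import all_boot all_order all_algebra.
From mathcomp Require Import all_classical all_reals all_analysis.
From mathcomp Require Import measurable_realfun ring lra.
Import Order.TTheory GRing.Theory Num.Theory.
Import numFieldNormedType.Exports.
Local Open Scope classical_set_scope.
Local Open Scope ring_scope.

(** Write [s = sigma (dot w x) - sigma (dot ws x)] and [t = dot (w - ws) x].

    Formally [dot (gradient f w) (w - ws)] is the expectation of
    [s * sigma' (dot w x) * t]. The mean value theorem gives
    [s * t >= alpha * t ^ 2], and [sigma' >= alpha], so the integrand is at least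
    [alpha ^ 2 * t ^ 2] pointwise: this is coherence
    ([alpha_increasing_coherent], [expected_loss_coherent]). The Lipschitz bound
    [`|s| <= L0 * `|t|] gives smoothness at once, because [f ws = 0]. Quasar
    convexity follows by eliminating [h] between the two inequalities
    ([quasar_convex_of_coherent_smooth]).

    The analytic content is that [f] is Frechet differentiable and that its
    differential is computed under the expectation. As [sigma'] need not be
    continuous, continuity of the partial derivatives is not available; instead
    [differentiable_Rintegral] is a Leibniz rule for Frechet differentials:
    pointwise differentiability, together with a local Lipschitz bound whose
    constant [K] is integrable, allows dominated convergence on the remainder.
    Since dominated convergence is about sequences, the remainder estimate is
    first reduced to sequences ([seq_littleo]).

    For the loss the Lipschitz constant is a multiple of [`|x| ^ 2], so a second
    moment of the distribution is needed. No moment is assumed, but finiteness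
    of the loss at every [w] provides it: since [`|s| >= alpha * `|t|], the loss
    at [ws + u] dominates [alpha ^ 2 / 2] times the expectation of
    [dot u x ^ 2], and letting [u] run through the canonical basis bounds the
    expectation of [`|x| ^ 2] ([integrable_sqr_dot], [integrable_sqr_norm]). *)

Set Implicit Arguments.
Unset Strict Implicit.
Unset Printing Implicit Defensive.

(** * Differentiation under the integral sign *)

(** If the bound failed in every ball of radius [1 / n.+1], the witnesses would
    form a sequence contradicting the hypothesis. *)
Lemma seq_littleo (R : realType) (V : normedModType R) (r : V -> R) :
  r 0 = 0 ->
  (forall u : nat -> V, (forall n, u n != 0) -> u n @[n --> \oo] --> 0 ->
     r (u n) / `|u n| @[n --> \oo] --> 0) ->
  forall e, 0 < e -> \forall h \near 0, `|r h| <= e * `|h|.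
Proof.
move=> r0 seqr e e0; apply: contrapT => nearF.
have /choice[u u_lt] : forall n, exists h,
    `|h| < n.+1%:R^-1 /\ e * `|h| < `|r h|.
  move=> n; apply: contrapT => /forallNP bnd; apply: nearF.
  apply/nbhs_norm0P; exists n.+1%:R^-1 => //= h hn.
  by rewrite leNgt; apply/negP => rh; apply: (bnd h).
have u0 n : u n != 0.
  by apply/eqP => un0; have [_] := u_lt n; rewrite un0 r0 !normr0 mulr0 ltxx.
have u_cvg : u n @[n --> \oo] --> 0.
  apply/cvgr0Pnorm_lt => eps eps0; near=> n.
  apply: lt_trans (u_lt n).1 _.
  near: n; exact: near_infty_natSinv_lt (PosNum eps0).
have /cvgr0Pnorm_lt /(_ _ e0)[N _ /(_ N (leqnn N))/=] := seqr u u0 u_cvg.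
have uN0 : 0 < `|u N| by rewrite normr_gt0.
rewrite normrM normfV normr_id ltr_pdivrMr// ltNge => /negP; apply.
exact: ltW (u_lt N).2.
Unshelve. all: by end_near. Qed.

Section leibniz_rule.
Context {R : realType} {V : normedModType R} {d} {T : measurableType d}.
Variables (mu : {measure set T -> \bar R}) (G : V -> T -> R) (w : V).
Variable K : T -> R.
Hypothesis intG : forall v, mu.-integrable setT (EFin \o G v).
Hypothesis diffG : forall x, differentiable (G^~ x) w.
Hypothesis intK : mu.-integrable setT (EFin \o K).
Hypothesis lipG : forall v x, `|v - w| <= 1 ->
  `|G v x - G w x| <= K x * `|v - w|.

Let dG (h : V) (x : T) : R := 'd (G^~ x) w h.

(* Sequential difference quotients: they transfer both the measurability and the
   Lipschitz bound of [G] to its differential. *)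
Let quotient_cvg h x :
  n.+1%:R * (G (n.+1%:R^-1 *: h + w) x - G w x) @[n --> \oo] --> dG h x.
Proof.
have dGhx : derivable (G^~ x) w h by exact: diff_derivable.
have harmN0 : @harmonic R n @[n --> \oo] --> (0 : R)^'.
  move=> A A0; have harmA := @cvg_harmonic R _ A0.
  apply: (@filterS _ \oo _ _ _ _ harmA) => n /=; apply.
  by rewrite gt_eqF ?harmonic_gt0.
have quot_cvg : t^-1 *: ((G^~ x \o shift w) (t *: h) - G w x) @[t --> (0 : R)^'] -->
    dG h x by rewrite /dG -deriveE.
have := cvg_comp _ _ harmN0 quot_cvg; apply: cvg_trans; apply: near_eq_cvg.
by near=> n; rewrite /= invrK.
Unshelve. all: by end_near. Qed.

Let quotient_norm_le h x : `|dG h x| <= K x * `|h|.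
Proof.
have /cvg_norm nq := @quotient_cvg h x.
rewrite -(cvg_lim _ nq)//; apply: limr_le; first exact: cvgP nq.
near=> n.
have n0 : 0 < n.+1%:R^-1 :> R by rewrite invr_gt0.
rewrite normrM (ger0_norm (ler0n _ _)) -ler_pdivlMl//.
have := @lipG (n.+1%:R^-1 *: h + w) x.
rewrite addrK normrZ (gtr0_norm n0) => /(_ _)/le_trans; apply.
  rewrite -ler_pdivlMl ?invr_gt0// invrK mulr1.
  rewrite (le_trans (_ : _ <= n%:R))// ?ler_nat//.
  by near: n; exact: nbhs_infty_ger.
by rewrite mulrCA.
Unshelve. all: by end_near. Qed.

Let measurable_dG h : measurable_fun setT (dG h).
Proof.
apply: (measurable_fun_cvg (h := fun n x =>
  n.+1%:R * (G (n.+1%:R^-1 *: h + w) x - G w x))) => //.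
  move=> n; apply: measurable_funM => //; apply: measurable_funB;
  by apply/measurable_EFinP; exact: measurable_int (intG _).
Qed.

Let integrable_dG h : mu.-integrable setT (EFin \o dG h).
Proof.
have : mu.-integrable setT (fun x => `|h|%:E * (EFin \o K) x)%E.
  exact: integrableZl.
apply: le_integrable => //; first exact/measurable_EFinP.
move=> x _; rewrite /= lee_fin mulrC (le_trans (quotient_norm_le _ _))//.
exact: ler_norm.
Qed.

Let F v := \int[mu]_x G v x.
Let L h := \int[mu]_x dG h x.

Let L_linear : linear L.
Proof.
move=> a u v; rewrite /L.
have -> : \int[mu]_x dG (a *: u + v) x = \int[mu]_x (a * dG u x + dG v x).
  by apply: eq_Rintegral => x _; rewrite /dG linearP.
rewrite RintegralD// ?RintegralZl//.
exact: (integrableZl measurableT a (integrable_dG u)).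
Qed.

Let L_norm_le h : `|L h| <= (\int[mu]_x K x) * `|h|.
Proof.
rewrite (le_trans (le_normr_Rintegral _ _))//.
rewrite -RintegralZr//; apply: le_Rintegral => //.
- exact: integrable_norm.
- rewrite (_ : _ \o _ = fun x => `|h|%:E * (EFin \o K) x)%E.
    exact: integrableZl.
  by apply/funext => x /=; rewrite mulrC.
Qed.

Let rem h x := G (h + w) x - G w x - dG h x.

Let rem_cvg (u : nat -> V) x : (forall n, u n != 0) -> u n @[n --> \oo] --> 0 ->
  rem (u n) x / `|u n| @[n --> \oo] --> 0.
Proof.
move=> u0 u_cvg; apply/cvgr0Pnorm_le => e e0.
have /diff_locallyP[_ /eqaddoP/(_ _ e0) near0] := @diffG x.
apply: (@filterS _ \oo _ _ _ _ (u_cvg _ near0)) => n /=.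
rewrite normrM normfV normr_id ler_pdivrMr ?normr_gt0//.
by rewrite opprD addrA.
Qed.

Let rem_le h x : `|h| <= 1 -> `|rem h x| <= 2 * K x * `|h|.
Proof.
move=> h1; rewrite (le_trans (ler_normB _ _))//.
have := @lipG (h + w) x; rewrite addrK => /(_ h1) Gle.
by have := @quotient_norm_le h x; lra.
Qed.

Let integrable_rem h : mu.-integrable setT (EFin \o rem h).
Proof.
have intGB := integrableB measurableT (intG (h + w)) (intG w).
exact: (integrableB measurableT intGB (integrable_dG h)).
Qed.

Let int_rem h : \int[mu]_x rem h x = F (h + w) - F w - L h.
Proof.
rewrite /rem RintegralB//; first by rewrite RintegralB.
exact: (integrableB measurableT (intG (h + w)) (intG w)).
Qed.

Let int_rem_cvg (u : nat -> V) : (forall n, u n != 0) -> u n @[n --> \oo] --> 0 ->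
  (F (u n + w) - F w - L (u n)) / `|u n| @[n --> \oo] --> 0.
Proof.
move=> u0 u_cvg.
have [N _ u1] : \forall n \near \oo, `|u n| <= 1.
  by move/cvgr0Pnorm_le : u_cvg; apply.
(* The Lipschitz bound, hence the domination, holds only once [`|u n| <= 1]. *)
rewrite -(cvg_shiftn N).
rewrite (_ : (fun n => _) = fine \o
    (fun n => \int[mu]_x (rem (u (n + N)%N) x / `|u (n + N)%N|)%:E)%E); last first.
  by apply/funext => n /=; rewrite -int_rem -RintegralZr.
apply: fine_cvg.
rewrite (_ : 0%:E = \int[mu]_x (cst 0 x))%E; last by rewrite integral0.
apply: (@dominated_cvg _ _ _ mu _ _ _ _ (fun x => 2%:E * (EFin \o K) x)%E) => //.
- move=> n; apply/measurable_EFinP; apply: measurable_funM => //.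
  by apply/measurable_EFinP; exact: measurable_int (integrable_rem _).
- move=> x _; apply: cvg_EFin; first exact: nearW.
  rewrite (cvg_shiftn N (fun n => rem (u n) x / `|u n|)).
  exact: rem_cvg.
- exact: integrableZl.
- move=> n x _; rewrite lee_fin normrM normfV normr_id.
  rewrite ler_pdivrMr ?normr_gt0//.
  by apply: rem_le; apply: u1; exact: leq_addl.
Qed.

(** Leibniz rule for Frechet differentials over an arbitrary normed space: divided
    by [`|h|], the remainder [rem h x] tends to [0] for each [x] and is bounded by
    [2 * K x], so its integral is [o(h)] by dominated convergence. *)
Lemma differentiable_Rintegral :
  differentiable (fun v => \int[mu]_x G v x) w /\
  forall h, mu.-integrable setT (EFin \o (fun x => 'd (G^~ x) w h)) /\
  'd (fun v => \int[mu]_x G v x) w h = \int[mu]_x 'd (G^~ x) w h.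
Proof.
pose lin := GRing.isLinear.Build _ _ _ _ _ L_linear.
pose LL : {linear V -> R} := HB.pack L lin.
have LL_cont : continuous LL.
  apply/bounded_linear_continuous/linear_boundedP.
  apply: filterS (nbhs_pinfty_ge (num_real (\int[mu]_x K x))) => r rK x.
  by rewrite (le_trans (L_norm_le _))// ler_wpM2r.
have F_exp : F \o shift w = cst (F w) + LL +o_ 0 id.
  apply/eqaddoP => e e0.
  have rem0 : F (0 + w) - F w - L 0 = 0.
    by rewrite add0r subrr (_ : L 0 = 0) ?subr0//; exact: (linear0 LL).
  have := seq_littleo (r := fun h => F (h + w) - F w - L h) rem0 int_rem_cvg e0.
  by apply: filterS => h /=; rewrite opprD addrA.
have dF := diff_unique LL_cont F_exp.
split; first by apply/diff_locallyP; rewrite dF.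
by move=> h; split; [exact: integrable_dG|rewrite dF].
Qed.

End leibniz_rule.

(** * The dot product on row vectors *)

Section dot_product.
Context {R : realType} {d : nat}.
Implicit Types u v x : 'rV[R]_d.

Lemma dotE u v : dot u v = \sum_i u 0 i * v 0 i.
Proof. by rewrite /dot mxE; apply: eq_bigr => i _; rewrite mxE. Qed.

Lemma dotC u v : dot u v = dot v u.
Proof. by rewrite !dotE; apply: eq_bigr => i _; rewrite mulrC. Qed.

Lemma dot_linear x : linear (@dot R d ^~ x).
Proof. by move=> a u v; rewrite /dot mulmxDl -scalemxAl !mxE. Qed.

(** Bundled as a linear map, so that lemmas on linear maps apply to the left
    argument of [dot]. *)
Definition dotr x : {linear 'rV[R]_d -> R} :=
  HB.pack (@dot R d ^~ x) (GRing.isLinear.Build _ _ _ _ _ (dot_linear x)).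

Lemma dotBl u v x : dot (u - v) x = dot u x - dot v x.
Proof. exact: (linearB (dotr x)). Qed.

Lemma dot_delta i x : dot (delta_mx 0 i) x = x 0 i.
Proof. by rewrite /dot -rowE !mxE. Qed.

Lemma entry_le_norm x i : `|x 0 i| <= `|x|.
Proof.
rewrite [leRHS]mx_normrE.
exact: (le_bigmax _ (fun ij : 'I_1 * 'I_d => `|x ij.1 ij.2|) (0, i)).
Qed.

(** The norm of row vectors is the maximum norm, whence the factor [d]. *)
Lemma norm_dot_le u x : `|dot u x| <= d%:R * `|x| * `|u|.
Proof.
rewrite dotE (le_trans (ler_norm_sum _ _ _))//.
have -> : d%:R * `|x| * `|u| = \sum_(i < d) `|u| * `|x|.
  by rewrite sumr_const card_ord -mulr_natl; ring.
by apply: ler_sum => i _; rewrite normrM ler_pM// entry_le_norm.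
Qed.

Lemma sqr_norm_le_sum x : `|x| ^+ 2 <= \sum_i x 0 i ^+ 2.
Proof.
have [->|x0] := eqVneq `|x| 0.
  by rewrite expr0n/=; apply: sumr_ge0 => i _; exact: sqr_ge0.
have [[j i] /= xE] := mx_norm_neq0 x0.
rewrite [`|x|]xE real_normK ?num_real// (ord1 j) (bigD1 i)//= lerDl.
by apply: sumr_ge0 => k _; exact: sqr_ge0.
Qed.

Lemma dot_continuous x : continuous (@dot R d ^~ x).
Proof.
rewrite -[_ ^~ _]/(dotr x : _ -> _).
apply/bounded_linear_continuous/linear_boundedP.
apply: filterS (nbhs_pinfty_ge (num_real (d%:R * `|x|))) => r rx u.
by rewrite (le_trans (norm_dot_le _ _))// ler_wpM2r.
Qed.

Lemma is_diff_dot x w : is_diff w (@dot R d ^~ x) (@dot R d ^~ x).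
Proof.
rewrite -[_ ^~ _]/(dotr x : _ -> _).
apply: DiffDef; first exact/linear_differentiable/dot_continuous.
by rewrite diff_lin//; exact: dot_continuous.
Qed.

(** [gradient] lists the directional derivatives along the canonical basis; for a
    differentiable [f] they determine the differential by linearity. *)
Lemma dot_gradient (f : 'rV[R]_d -> R) w u :
  differentiable f w -> dot (gradient f w) u = 'd f w u.
Proof.
move=> df; rewrite [in RHS](row_sum_delta u) linear_sum dotE.
by apply: eq_bigr => i _; rewrite mxE deriveE// linearZ/= mulrC.
Qed.

Lemma continuous_measurable_rV (f : 'rV[R]_d -> R) :
  continuous f -> measurable_fun setT (f : borel_rV R d -> R).
Proof.
move=> /continuousP cf; apply: (measurability _ (RGenOpens.measurableE R)).
move=> _ [_ [a [b ->] <-]]; rewrite setTI.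
by apply: sub_sigma_algebra; exact/cf/interval_open.
Qed.

Lemma measurable_dot w : measurable_fun setT (dot w : borel_rV R d -> R).
Proof.
apply: continuous_measurable_rV.
rewrite (_ : dot w = @dot R d ^~ w); first exact: dot_continuous.
by apply/funext => x; exact: dotC.
Qed.

End dot_product.

(** * Increasing activation functions *)

Section alpha_increasing.
Context {R : realType}.
Variables (sigma : R -> R) (alpha : R).
Hypothesis sigma_increasing : alpha_increasing alpha sigma.

Let alpha_gt0 : 0 < alpha := sigma_increasing.1.

Lemma alpha_increasing_continuous : continuous sigma.
Proof.
move=> z; apply: differentiable_continuous; apply/derivable1_diffP.
exact: (sigma_increasing.2 z).1.
Qed.

(** Mean value theorem: [sigma a - sigma b = sigma' c * (a - b)]. The product form
    keeps the sign information that the absolute values below forget. *)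
Lemma alpha_increasing_sqr_le a b :
  alpha * (a - b) ^+ 2 <= (sigma a - sigma b) * (a - b).
Proof.
wlog ba : a b / b <= a.
  move=> H; have [/H//|/ltW/H] := leP b a.
  have <- : (b - a) ^+ 2 = (a - b) ^+ 2 by ring.
  have <- : (sigma b - sigma a) * (b - a) = (sigma a - sigma b) * (a - b).
    by ring.
  by [].
have [||c _ ->] := @MVT_segment R sigma (derive1 sigma) b a ba.
- move=> z _; apply: DeriveDef; first exact: (sigma_increasing.2 z).1.
  by rewrite derive1E.
- exact/continuous_subspaceT/alpha_increasing_continuous.
- by rewrite -mulrA -expr2 ler_wpM2r ?sqr_ge0//; exact: (sigma_increasing.2 c).2.
Qed.

Lemma alpha_increasing_norm_le a b :
  alpha * `|a - b| <= `|sigma a - sigma b|.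
Proof.
have [->|ab] := eqVneq a b; first by rewrite !subrr normr0 mulr0.
rewrite -(ler_pM2r (_ : 0 < `|a - b|)) ?normr_gt0 ?subr_eq0//.
rewrite -mulrA -expr2 real_normK ?num_real//.
by rewrite (le_trans (alpha_increasing_sqr_le a b))// -normrM ler_norm.
Qed.

(** Pointwise form of coherence: the bound of [alpha_increasing_sqr_le] is
    nonnegative, so it may be multiplied by [derive1 sigma a >= alpha]. *)
Lemma alpha_increasing_coherent a b :
  alpha ^+ 2 * (a - b) ^+ 2 <=
  (sigma a - sigma b) * (derive1 sigma a * (a - b)).
Proof.
rewrite [leRHS]mulrCA expr2 -mulrA.
rewrite ler_pM ?alpha_increasing_sqr_le ?(ltW alpha_gt0)//.
- by rewrite mulr_ge0 ?sqr_ge0// ltW.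
- exact: (sigma_increasing.2 a).2.
Qed.

(** Makes [L0] positive, so that the quasar convexity constant is positive and
    its inverse meaningful. *)
Lemma alpha_increasing_le_lipschitz L :
  L.-lipschitz sigma -> alpha <= L.
Proof.
move=> /(_ (1, 0)) /= /(_ (conj I I)); rewrite subr0 normr1 mulr1.
by apply: le_trans; have := alpha_increasing_norm_le 1 0;
  rewrite subr0 normr1 mulr1.
Qed.

End alpha_increasing.

(** * The expected loss *)

Section regression_loss.
Context {R : realType} {d : nat}.
Variables (D : probability (borel_rV R d) R) (ws : 'rV[R]_d).
Variables (sigma : R -> R) (L0 alpha : R).
Hypothesis sigma_lipschitz : L0.-lipschitz sigma.
Hypothesis sigma_increasing : alpha_increasing alpha sigma.
Hypothesis loss_finite : forall w, expected_loss D sigma ws w \is a fin_num.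

Let alpha_gt0 : 0 < alpha := sigma_increasing.1.

Let L0_ge0 : 0 <= L0.
Proof.
apply: (le_trans (ltW alpha_gt0)).
exact: alpha_increasing_le_lipschitz sigma_increasing _ sigma_lipschitz.
Qed.

Let sigma_lip a b : `|sigma a - sigma b| <= L0 * `|a - b|.
Proof. by have := @sigma_lipschitz (a, b); exact. Qed.

Definition sample_loss (w : 'rV[R]_d) (x : borel_rV R d) : R :=
  2^-1 * (sigma (dot w x) - sigma (dot ws x)) ^+ 2.

Lemma sample_loss_ge0 w x : 0 <= sample_loss w x.
Proof. by rewrite mulr_ge0// sqr_ge0. Qed.

Lemma expected_lossE w :
  expected_loss D sigma ws w = (\int[D]_x (sample_loss w x)%:E)%E.
Proof. by rewrite /expected_loss unlock. Qed.

Lemma mean_square_gapE u v :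
  mean_square_gap D u v = (\int[D]_x (dot (u - v) x ^+ 2)%:E)%E.
Proof. by rewrite /mean_square_gap unlock. Qed.

Lemma measurable_sample_loss w : measurable_fun setT (sample_loss w).
Proof.
have msigma := continuous_measurable_fun
  (alpha_increasing_continuous sigma_increasing).
apply: measurable_funM => //; apply: measurable_funX.
by apply: measurable_funB; apply: measurableT_comp (measurable_dot _).
Qed.

Lemma integrable_sample_loss w : D.-integrable setT (EFin \o sample_loss w).
Proof.
apply/integrableP; split.
  by apply/measurable_EFinP; exact: measurable_sample_loss.
under eq_integral do rewrite /= ger0_norm ?sample_loss_ge0//.
by rewrite -expected_lossE ltey_eq loss_finite.
Qed.

(** Finite loss forces finite second moments: [dot w x] is the gap between the
    inputs of [sigma] at [w + ws] and at [ws], so its square is at most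
    [2 / alpha ^ 2] times the loss at [w + ws]. *)
Lemma integrable_sqr_dot w :
  D.-integrable setT (EFin \o (fun x : borel_rV R d => dot w x ^+ 2)).
Proof.
pose k := 2 / alpha ^+ 2.
have : D.-integrable setT (fun x => k%:E * (EFin \o sample_loss (w + ws)) x)%E.
  exact/integrableZl/integrable_sample_loss.
apply: le_integrable => //.
  by apply/measurable_EFinP/measurable_funX; exact: measurable_dot.
move=> x _; rewrite /= lee_fin.
rewrite !ger0_norm ?sqr_ge0//; last first.
  by rewrite mulr_ge0 ?sample_loss_ge0// divr_ge0 ?sqr_ge0.
rewrite /k /sample_loss; set s := sigma _ - sigma _.
have -> : 2 / alpha ^+ 2 * (2^-1 * s ^+ 2) = s ^+ 2 / alpha ^+ 2.
  by field; rewrite gt_eqF.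
rewrite ler_pdivlMr ?exprn_gt0// mulrC -exprMn.
rewrite -[leLHS]real_normK ?num_real// -[leRHS]real_normK ?num_real//.
rewrite ler_sqr ?nnegrE// normrM (gtr0_norm alpha_gt0).
have -> : dot w x = dot (w + ws) x - dot ws x by rewrite -dotBl addrK.
exact: alpha_increasing_norm_le.
Qed.

Lemma integrable_sqr_norm :
  D.-integrable setT (EFin \o (fun x : borel_rV R d => `|x : 'rV[R]_d| ^+ 2)).
Proof.
have : D.-integrable setT
    (fun x : borel_rV R d => \sum_(i < d) (dot 'e_i x ^+ 2)%R%:E)%E.
  by apply: integrable_sum => // i _; exact: integrable_sqr_dot.
apply: le_integrable => //.
  apply/measurable_EFinP/measurable_funX; apply: continuous_measurable_rV.
  exact: norm_continuous.
move=> x _; rewrite /= sumEFin/= lee_fin ger0_norm ?sqr_ge0//.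
rewrite ger0_norm; last by apply: sumr_ge0 => i _; exact: sqr_ge0.
under eq_bigr do rewrite dot_delta.
exact: sqr_norm_le_sum.
Qed.

Lemma is_diff_sample_loss w x : is_diff w (sample_loss^~ x)
  (fun h => (sigma (dot w x) - sigma (dot ws x)) *
            (derive1 sigma (dot w x) * dot h x)).
Proof.
have ds : derivable sigma (dot w x) 1 by exact: (sigma_increasing.2 _).1.
have dsigma : is_diff (dot w x) sigma ( *:%R^~ (derive1 sigma (dot w x))).
  by apply: DiffDef; [exact/derivable1_diffP|exact: deriv1E].
have ddot := is_diff_dot x w.
have -> : sample_loss^~ x =
    2^-1 *: ((sigma \o (@dot R d ^~ x)) - cst (sigma (dot ws x))) ^+ 2.
  by apply/funext => v; rewrite /sample_loss.
apply: is_diff_eq; apply/funext => h /=.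
rewrite expr1 subr0 -[LHS]/(2^-1 *
  (2 * (sigma (dot w x) - sigma (dot ws x)) *
   (dot h x * derive1 sigma (dot w x)))).
by field.
Qed.

(** Factor the difference of squares: one factor is [O(`|x| * `|v - w|)] and the
    other [O(`|x|)], which gives a Lipschitz constant integrable in [x]. *)
Lemma sample_loss_locally_lipschitz w v x : `|v - w| <= 1 ->
  `|sample_loss v x - sample_loss w x| <=
  2^-1 * (L0 * d%:R) ^+ 2 * (1 + 2 * `|w - ws|) *
    `|x : 'rV[R]_d| ^+ 2 * `|v - w|.
Proof.
move=> vw1.
pose N := d%:R * `|x : 'rV[R]_d|.
have N0 : 0 <= N by rewrite mulr_ge0.
have lip u u' : `|sigma (dot u x) - sigma (dot u' x)| <= L0 * (N * `|u - u'|).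
  by rewrite (le_trans (sigma_lip _ _))// ler_wpM2l// -dotBl norm_dot_le.
have -> : sample_loss v x - sample_loss w x =
    2^-1 * ((sigma (dot v x) - sigma (dot w x)) *
            ((sigma (dot v x) - sigma (dot w x)) +
             2 * (sigma (dot w x) - sigma (dot ws x)))).
  by rewrite /sample_loss; ring.
rewrite !normrM ger0_norm//.
(* The factor [1] stands for [`|v - w|] in the bound of the second factor. *)
have -> : 2^-1 * (L0 * d%:R) ^+ 2 * (1 + 2 * `|w - ws|) *
    `|x : 'rV[R]_d| ^+ 2 * `|v - w| =
    2^-1 * ((L0 * (N * `|v - w|)) * (L0 * (N * 1) + 2 * (L0 * (N * `|w - ws|)))).
  by rewrite /N; ring.
rewrite ler_wpM2l// ler_pM ?lip//.
rewrite (le_trans (ler_normD _ _))// lerD//.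
  by rewrite (le_trans (lip _ _))// !ler_wpM2l.
by rewrite normrM (ger0_norm (ler0n _ 2)) ler_wpM2l.
Qed.

Let f w := fine (expected_loss D sigma ws w).
Let h w := \int[D]_x (dot (w - ws) x ^+ 2).

(** The gap is a real number, which brings the two inequalities below from
    extended reals to reals. *)
Lemma mean_square_gap_EFin w : mean_square_gap D w ws = (h w)%:E.
Proof.
rewrite mean_square_gapE /h /Rintegral fineK//.
exact/integrable_fin_num/integrable_sqr_dot.
Qed.

(** Integrability of the differential is kept in the conclusion: integrals are
    compared through it in [expected_loss_coherent]. *)
Lemma expected_loss_diff w :
  differentiable f w /\ forall u,
  D.-integrable setT (EFin \o (fun x : borel_rV R d =>
    (sigma (dot w x) - sigma (dot ws x)) * (derive1 sigma (dot w x) * dot u x))) /\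
  'd f w u = \int[D]_x ((sigma (dot w x) - sigma (dot ws x)) *
                         (derive1 sigma (dot w x) * dot u x)).
Proof.
pose C := 2^-1 * (L0 * d%:R) ^+ 2 * (1 + 2 * `|w - ws|).
have intK : D.-integrable setT
    (EFin \o (fun x : borel_rV R d => C * `|x : 'rV[R]_d| ^+ 2)).
  exact: (integrableZl measurableT C integrable_sqr_norm).
have := differentiable_Rintegral integrable_sample_loss _ intK
  (sample_loss_locally_lipschitz (w := w)).
have -> : f = fun v => \int[D]_x sample_loss v x.
  by apply/funext => v; rewrite /f expected_lossE.
case=> [x|df dfE]; first by have dl := is_diff_sample_loss w x; exact: ex_diff.
split=> // u; have [int_d dE] := dfE u.
have dlE x : 'd (sample_loss^~ x) w u = (sigma (dot w x) - sigma (dot ws x)) *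
    (derive1 sigma (dot w x) * dot u x).
  by have dl := is_diff_sample_loss w x; rewrite diff_val.
split; last by rewrite dE; apply: eq_Rintegral => x _.
by apply: eq_integrable int_d => // x _; rewrite /= dlE.
Qed.

Lemma expected_loss_ws : f ws = 0.
Proof.
rewrite /f expected_lossE (_ : (fun _ => _) = cst 0%E) ?integral0//.
by apply/funext => x; rewrite /sample_loss subrr expr0n mulr0.
Qed.

Lemma expected_loss_minimizer : global_minimizer f ws.
Proof.
move=> w; rewrite expected_loss_ws /f expected_lossE.
by apply/fine_ge0/integral_ge0 => x _; rewrite lee_fin sample_loss_ge0.
Qed.

Lemma expected_loss_coherent w :
  alpha ^+ 2 * h w <= dot (gradient f w) (w - ws).
Proof.
have [df dfE] := expected_loss_diff w.
rewrite dot_gradient//; have [int_d ->] := dfE (w - ws).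
rewrite /h -RintegralZl//; last exact: integrable_sqr_dot.
apply: le_Rintegral => //.
  exact: (integrableZl measurableT (alpha ^+ 2) (integrable_sqr_dot (w - ws))).
by move=> x _; rewrite dotBl; exact: alpha_increasing_coherent.
Qed.

Lemma expected_loss_smooth w : f w - f ws <= L0 ^+ 2 / 2 * h w.
Proof.
rewrite expected_loss_ws subr0 /h -RintegralZl//; last exact: integrable_sqr_dot.
rewrite /f expected_lossE -/(Rintegral _ _ _); apply: le_Rintegral => //.
- exact: integrable_sample_loss.
- exact: (integrableZl measurableT (L0 ^+ 2 / 2) (integrable_sqr_dot (w - ws))).
- move=> x _; rewrite /sample_loss mulrAC mulrC ler_wpM2r// -exprMn.
  rewrite -[leLHS]real_normK ?num_real// -[leRHS]real_normK ?num_real//.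
  by rewrite ler_sqr ?nnegrE// normrM (ger0_norm L0_ge0) dotBl.
Qed.

End regression_loss.

Lemma mean_square_gap_ge0 (R : realType) (d : nat)
  (D : probability (borel_rV R d) R) u v : (0 <= mean_square_gap D u v)%E.
Proof.
by rewrite mean_square_gapE; apply: integral_ge0 => x _; rewrite lee_fin sqr_ge0.
Qed.

(** * Quasar convexity and the main result *)

(** Chains [f w - f ws <= Cl * h] with [Cv * h <= dot (gradient f w) (w - ws)].
    Coherence bounds [Cv * h] by a real number, so [h] is finite. *)
Lemma quasar_convex_of_coherent_smooth (R : realType) (d : nat)
    (f : 'rV[R]_d -> R) ws (h : 'rV[R]_d -> 'rV[R]_d -> \bar R) Cv Cl :
  0 < Cv -> 0 < Cl ->
  generalized_variational_coherent f ws h Cv ->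
  generalized_smooth f ws h Cl ->
  quasar_convex f ws (Cv / Cl).
Proof.
move=> Cv0 Cl0 [fmin h0 df coh] [_ _ smooth]; split=> //.
  exact: divr_gt0.
have h_fin w : h w ws \is a fin_num.
  rewrite ge0_fin_numE// ltNge leye_eq; apply/negP => /eqP hoo.
  by have := coh w; rewrite hoo gt0_muley.
move=> w; have := coh w; have := smooth w.
rewrite -(fineK (h_fin w)) -!EFinM !lee_fin; set H := fine _ => fH HG.
have -> : dot (gradient f w) (ws - w) = - dot (gradient f w) (w - ws).
  by rewrite -opprB dotC [in RHS]dotC; exact: (linearN (dotr _)).
rewrite mulrN lerBlDr addrC -lerBlDr (le_trans fH)//.
by rewrite invf_div mulrAC ler_pdivlMr// mulrC mulrCA ler_pM2l// mulrC.
Qed.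

Unset Implicit Arguments.

Theorem lemma3 (R : realType) (d : nat) (D : probability (borel_rV R d) R)
    (ws : 'rV[R]_d) (sigma : R -> R) (L0 alpha : R)
    (sigma_lipschitz : L0.-lipschitz sigma)
    (sigma_increasing : alpha_increasing alpha sigma)
    (loss_finite : forall w, expected_loss D sigma ws w \is a fin_num) :
  let f := fun w => fine (expected_loss D sigma ws w) in
  [/\ generalized_variational_coherent f ws (mean_square_gap D) (alpha ^+ 2),
      generalized_smooth f ws (mean_square_gap D) (L0 ^+ 2 / 2) &
      quasar_convex f ws (2 * alpha ^+ 2 / L0 ^+ 2)].
Proof.
move=> f.
have a0 : 0 < alpha := sigma_increasing.1.
have L00 : 0 < L0.
  apply: lt_le_trans a0 _.
  exact: alpha_increasing_le_lipschitz sigma_increasing _ sigma_lipschitz.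
have hE := mean_square_gap_EFin sigma_increasing loss_finite.
have fmin := expected_loss_minimizer D ws sigma.
have coh :
    generalized_variational_coherent f ws (mean_square_gap D) (alpha ^+ 2).
  split=> // [||w]; [exact: mean_square_gap_ge0|..].
    move=> w.
    exact: (expected_loss_diff sigma_lipschitz sigma_increasing loss_finite w).1.
  rewrite hE -EFinM lee_fin.
  exact: (expected_loss_coherent sigma_lipschitz sigma_increasing loss_finite).
have smooth : generalized_smooth f ws (mean_square_gap D) (L0 ^+ 2 / 2).
  split=> // [|w]; first exact: mean_square_gap_ge0.
  rewrite hE -EFinM lee_fin.
  exact: (expected_loss_smooth sigma_lipschitz sigma_increasing loss_finite).
split=> //.
have -> : 2 * alpha ^+ 2 / L0 ^+ 2 = alpha ^+ 2 / (L0 ^+ 2 / 2).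
  by field; rewrite gt_eqF.
apply: quasar_convex_of_coherent_smooth coh smooth => //.
  exact: exprn_gt0.
by rewrite divr_gt0// exprn_gt0.
Qed.
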